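(* Let $A\in\mathbb{C}^{l\times m\times n}$, let $r$ be a positive integer, and let $\mu_1,\mu_2,\mu_3$ be bounds defining the following families of dictionaries of $r$ unit vectors (a matrix is identified with the collection of its columns, which are required to be unit vectors): $\mathcal{U}=\{U\in\mathbb{C}^{l\times r}\mid \mu(U)\le\mu_1\}$, $\mathcal{V}=\{V\in\mathbb{C}^{m\times r}\mid \mu(V)\le\mu_2\}$, $\mathcal{W}=\{W\in\mathbb{C}^{n\times r}\mid \mu(W)\le\mu_3\}$, where $\mu(\cdot)$ denotes coherence. Write $\mathbf{u}_p,\mathbf{v}_p,\mathbf{w}_p$ for the $p$th columns of $U,V,W$. If $$\mu_1\mu_2\mu_3<\frac{1}{r},$$ then the infimum $$\eta=\inf\Bigl\{\Bigl\Vert A-\sum_{p=1}^{r}\lambda_p\,\mathbf{u}_p\otimes\mathbf{v}_p\otimes\mathbf{w}_p\Bigr\Vert \;\Big|\; \boldsymbol{\lambda}=(\lambda_1,\dots,\lambda_r)\in\mathbb{C}^r,\ U\in\mathcal{U},\ V\in\mathcal{V},\ W\in\mathcal{W}\Bigr\}$$ is attained. Here $\lVert\cdot\rVert$ denotes any norm on $\mathbb{C}^{l\times m\times n}$.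
   Context: $\mathbb{C}^{l\times m\times n}$ is the space of arrays $(a_{ijk})$ with $1\le i\le l$, $1\le j\le m$, $1\le k\le n$. For $\mathbf{u}\in\mathbb{C}^l$, $\mathbf{v}\in\mathbb{C}^m$, $\mathbf{w}\in\mathbb{C}^n$, $\mathbf{u}\otimes\mathbf{v}\otimes\mathbf{w}:=(u_iv_jw_k)_{i,j,k}$. For a finite collection $V=\{\mathbf{v}_1,\dots,\mathbf{v}_r\}$ of unit vectors in a Hilbert space (here $\mathbb{C}^l$, $\mathbb{C}^m$ or $\mathbb{C}^n$ with the standard Hermitian inner product and norm $\lVert\cdot\rVert_2$), indexed by $p=1,\dots,r$, the coherence is $\mu(V):=\max_{p\ne q}\lvert\langle\mathbf{v}_p,\mathbf{v}_q\rangle\rvert$. For a matrix with unit-norm columns, the coherence is that of the collection of its columns. *)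

(* Defs.v *)
From mathcomp Require Import all_boot all_order all_algebra.
From mathcomp Require Import all_classical all_reals.
From mathcomp Require Import complex.

Set Implicit Arguments.
Unset Strict Implicit.
Unset Printing Implicit Defensive.

Import Order.TTheory GRing.Theory Num.Theory.
Import ComplexField.Normc.
Local Open Scope ring_scope.
Local Open Scope classical_set_scope.
Local Open Scope complex_scope.

(* [dotmx] is the standard Hermitian product, defined on row vectors. *)
Definition hdot (R : realType) (d : nat) (u v : 'cV[R[i]]_d) : R[i] :=
  dotmx u^T v^T.

Definition norm2 (R : realType) (d : nat) (u : 'cV[R[i]]_d) : R[i] :=
  sqrtC (hdot u u).

(* The maximum over the empty set (r <= 1) is 0. *)
Definition coherence (R : realType) (d r : nat) (U : 'M[R[i]]_(d, r)) : R :=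
  \big[Num.max/0]_(pq : 'I_r * 'I_r | pq.1 != pq.2)
    normc (hdot (col pq.1 U) (col pq.2 U)).

Definition dictionaries (R : realType) (d r : nat) (mu : R) :
    set 'M[R[i]]_(d, r) :=
  [set U | (forall p, norm2 (col p U) = 1) /\ coherence U <= mu].

Notation tensor R l m n := {ffun 'I_l * 'I_m * 'I_n -> R[i]}.

Definition outer (R : realType) (l m n : nat)
    (u : 'cV[R[i]]_l) (v : 'cV[R[i]]_m) (w : 'cV[R[i]]_n) : tensor R l m n :=
  [ffun ijk => u ijk.1.1 0 * v ijk.1.2 0 * w ijk.2 0].

Definition is_norm (R : realType) (V : lmodType R[i]) (N : V -> R) : Prop :=
  [/\ forall x, 0 <= N x,
      forall x, N x = 0 -> x = 0,
      forall a x, N (a *: x) = normc a * N x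
    & forall x y, N (x + y) <= N x + N y].

Definition approx_error (R : realType) (l m n r : nat)
    (N : tensor R l m n -> R) (A : tensor R l m n) (lambda : 'rV[R[i]]_r)
    (U : 'M[R[i]]_(l, r)) (V : 'M[R[i]]_(m, r)) (W : 'M[R[i]]_(n, r)) : R :=
  N (A - \sum_(p < r) lambda 0 p *: outer (col p U) (col p V) (col p W)).

Definition approx_errors (R : realType) (l m n r : nat)
    (N : tensor R l m n -> R) (A : tensor R l m n) (mu1 mu2 mu3 : R) : set R :=
  [set e | exists (lambda : 'rV[R[i]]_r) U V W,
    [/\ dictionaries mu1 U, dictionaries mu2 V, dictionaries mu3 W
      & e = approx_error N A lambda U V W]].
Arguments approx_errors {R l m n} r N A mu1 mu2 mu3.

(* Main.v *)
Require Import Defs.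
From mathcomp Require Import all_boot all_order all_algebra.
From mathcomp Require Import all_classical all_reals.
From mathcomp Require Import complex.
From mathcomp Require Import topology normedtype derive function_spaces.
From mathcomp Require Import ring lra.

(* If [S = \sum_p a_p u_p (x) v_p (x) w_p], expanding the Hermitian square of
   [S] gives [|S|^2 >= (1 - r mu1 mu2 mu3) \sum_p |a_p|^2], so the coefficients
   of any approximation no worse than [0] stay bounded.  The minimisation then
   takes place on a closed bounded set of parameters, where a continuous
   function attains its minimum. *)

Import Order.TTheory GRing.Theory Num.Theory.
Import ComplexField.Normc numFieldNormedType.Exports.

Local Open Scope ring_scope.
Local Open Scope classical_set_scope.
Local Open Scope complex_scope.

(** * The real-valued modulus on the complex numbers *)

Section ComplexModulus.
Context {R : realType}.
Implicit Types (x y : R[i]) (a : R).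

Lemma normcD x y : normc (x + y) <= normc x + normc y.
Proof. exact: (@le_normcD R x y). Qed.

Lemma normc_ge0 x : 0 <= normc x.
Proof. by case: x => a b; apply: sqrtr_ge0. Qed.

Lemma normcB x y : normc (x - y) = normc (y - x).
Proof. by rewrite -opprB; exact: (@normcN R (y - x)). Qed.

Lemma normc_real a : normc a%:C = `|a|.
Proof. by rewrite /= expr0n addr0 sqrtr_sqr. Qed.

Lemma normc_conj x : normc (x^*)%R = normc x.
Proof. by apply: complexI; exact: (@norm_conjC _ x). Qed.

Lemma normc_sqr x : (normc x ^+ 2)%:C = x * (x^*)%R.
Proof. by rewrite rmorphXn /=; exact: (@normCK _ x). Qed.

Lemma normc_sum {I : finType} (P : pred I) (F : I -> R[i]) :
  normc (\sum_(k | P k) F k) <= \sum_(k | P k) normc (F k).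
Proof.
elim/big_ind2 : _ => // [|a x b y xa yb]; first by rewrite normc0.
exact: le_trans (normcD x y) (lerD xa yb).
Qed.

End ComplexModulus.

(** * Continuity of complex-valued functions *)

(* [R[i]] has no canonical topology in the library; its alias [R[i]^o] does. *)
Section ComplexContinuity.
Context {R : realType} {T : topologicalType}.

Lemma normc_dist (x y : R[i]) : `|normc x - normc y| <= normc (x - y).
Proof.
have xy := normcD (x - y) y; have yx := normcD (y - x) x.
by rewrite !subrK normcB in xy yx *; rewrite ler_norml; apply/andP; split; lra.
Qed.

Lemma continuous_normc (f : T -> R[i]^o) :
  continuous f -> continuous (fun t => normc (f t)).
Proof.
move=> cf t; apply/cvgrPdist_lt => e e0.
have e0C : (0 : R[i]) < e%:C by rewrite ltcR.
have /cvgrPdist_lt /(_ _ e0C) := cf t.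
(* The norm of [R[i]^o] takes values in [R[i]]: it is the real modulus, embedded. Unfolding it
   leaves a comparison of reals. *)
apply: filterS => s; rewrite -[`|_|]/((normc (f t - f s))%:C) ltcR.
exact: le_lt_trans (normc_dist _ _).
Qed.

Lemma continuous_real_complex (f : T -> R) :
  continuous f -> continuous (fun t => (f t)%:C : R[i]^o).
Proof.
move=> cf t; apply/cvgrPdist_lt => e e0.
(* In the partial order of [R[i]] a positive element is real, so the complex radius [e] comes from a
   real [d]. *)
have [d eE] : exists d : R, e = d%:C.
  by exists (complex.Re e); rewrite RRe_real// ger0_real// ltW.
move: e0; rewrite eE ltcR => d0.
have /cvgrPdist_lt /(_ _ d0) := cf t.
apply: filterS => s.
rewrite -[`|_ : R[i]^o|]/((normc ((f t)%:C - (f s)%:C))%:C) ltcR.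
by rewrite -rmorphB normc_real.
Qed.

Lemma continuous_conjC (f : T -> R[i]^o) :
  continuous f -> continuous (fun t => ((f t : R[i])^*)%R : R[i]^o).
Proof.
move=> cf t; apply/cvgrPdist_lt => e e0.
have /cvgrPdist_lt /(_ _ e0) := cf t; apply: filterS => s.
rewrite -[X in _ -> X < _]/(`|((f t : R[i])^* - (f s : R[i])^*)%R : R[i]|).
by rewrite -rmorphB norm_conjC.
Qed.

Lemma continuous_addC (f g : T -> R[i]^o) :
  continuous f -> continuous g -> continuous (fun t => f t + g t : R[i]^o).
Proof.
by move=> cf cg t; apply: (@cvgD R[i] R[i]^o); [exact: cf|exact: cg].
Qed.

Lemma continuous_mulC (f g : T -> R[i]^o) :
  continuous f -> continuous g ->
  continuous (fun t => (f t : R[i]) * g t : R[i]^o).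
Proof. by move=> cf cg t; apply: (@cvgM R[i]); [exact: cf|exact: cg]. Qed.

Lemma continuous_sumC (I : Type) (s : seq I) (P : pred I)
    (f : I -> T -> R[i]^o) :
  (forall k, continuous (f k)) ->
  continuous (fun t => \sum_(k <- s | P k) f k t : R[i]^o).
Proof.
move=> cf; apply: (@continuous_big R[i]^o).
  exact: (@add_continuous R[i]^o).
by move=> k _; exact: cf.
Qed.

Lemma continuous_sumR (I : Type) (s : seq I) (P : pred I) (f : I -> T -> R) :
  (forall k, continuous (f k)) ->
  continuous (fun t => \sum_(k <- s | P k) f k t).
Proof.
move=> cf; apply: (@continuous_big R).
  exact: (@add_continuous R).
by move=> k _; exact: cf.
Qed.

End ComplexContinuity.

(** * Minima on closed bounded sets of complex families *)

Section BoundedMinimum.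
Context {R : realType}.

(** A square rather than a disc, because it is the continuous image of a product of two compact
    segments. *)
Lemma compact_square (B : R) :
  compact [set z : R[i]^o | exists a b : R,
    [/\ `|a| <= B, `|b| <= B & z = a +i* b]].
Proof.
have cB := @segment_compact R (- B) B.
have -> : [set z : R[i]^o | exists a b : R,
    [/\ `|a| <= B, `|b| <= B & z = a +i* b]] =
    (fun ab : R * R => ab.1 +i* ab.2 : R[i]^o) @` (`[- B, B] `*` `[- B, B]).
  apply/seteqP; split => [z [a [b [aB bB ->]]]|z [[a b] [/= aB bB] <-]].
    by exists (a, b) => //; split; rewrite /= in_itv /= -ler_norml.
  by exists a, b; split; rewrite // ler_norml; move: aB bB; rewrite !in_itv.
apply: continuous_compact; last exact: compact_setX.
apply: continuous_subspaceT.
have -> : (fun ab : R * R => ab.1 +i* ab.2 : R[i]^o) =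
    (fun ab => ab.1%:C + ('i%C : R[i]) * ab.2%:C).
  by apply/funext => -[a b]; rewrite [LHS]complexE.
apply: continuous_addC.
  by apply: continuous_real_complex => x; exact: cvg_fst.
apply: continuous_mulC; first by move=> x; exact: cvg_cst.
by apply: continuous_real_complex => x; exact: cvg_snd.
Qed.

(** [D] is closed in a product of squares, compact by Tychonoff, so the extreme value theorem
    applies. In the product topology the coordinates are continuous by construction. *)
Lemma bounded_closed_min {J : finType}
    {f : prod_topology (fun _ : J => R[i]^o) -> R}
    {D : set (prod_topology (fun _ : J => R[i]^o))} {B : R} :
  D !=set0 -> closed D -> (forall x, D x -> forall j, normc (x j) <= B) ->
  continuous f ->
  exists2 x, D x & forall y, D y -> f x <= f y.
Proof.
move=> D0 cD DB cf.
have kD : compact D.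
  apply: subclosed_compact cD (tychonoff (fun _ : J => compact_square B)) _.
  move=> x Dx j /=; have := DB x Dx j.
  case: (x j) => a b /= abB; exists a, b; split => //.
    (* The disc lies in the square: [|a|] is the root of [a ^+ 2], at most that of
       [a ^+ 2 + b ^+ 2]. *)
    by apply: le_trans abB; rewrite -sqrtr_sqr ler_wsqrtr// lerDl sqr_ge0.
  by apply: le_trans abB; rewrite -sqrtr_sqr ler_wsqrtr// lerDr sqr_ge0.
have [c cD' cmin] := compact_EVT_min D0 kD (continuous_subspaceT cf).
exists c; first exact: set_mem.
by move=> y Dy; apply: cmin; exact: mem_set.
Qed.

Lemma continuous_coord (J : finType) (j : J) :
  continuous (fun x : prod_topology (fun _ : J => R[i]^o) => x j).
Proof. exact: (@proj_continuous J (fun _ => R[i]^o) j). Qed.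

End BoundedMinimum.

(** * Comparison of an arbitrary norm with the sum of moduli *)

Section FiniteDimensionalNorm.
Context {R : realType} {K : finType} {N : {ffun K -> R[i]} -> R}.
Hypothesis normN : is_norm N.

Let N_ge0 x : 0 <= N x. Proof. by case: normN. Qed.
Let N_eq0 x : N x = 0 -> x = 0. Proof. by case: normN => _ h _ _; exact: h. Qed.
Let NZ a x : N (a *: x) = normc a * N x. Proof. by case: normN. Qed.
Let ND x y : N (x + y) <= N x + N y. Proof. by case: normN. Qed.

Lemma is_norm0 : N 0 = 0.
Proof. by rewrite -(scale0r 0) NZ normc0 mul0r. Qed.

Lemma is_normN x : N (- x) = N x.
Proof. by rewrite -scaleN1r NZ (@normcN R 1) normc1 mul1r. Qed.

Lemma is_norm_dist x y : `|N x - N y| <= N (x - y).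
Proof.
have xy := ND (x - y) y; have yx := ND (y - x) x.
rewrite !subrK in xy yx; rewrite -opprB is_normN in yx.
by rewrite ler_norml; apply/andP; split; lra.
Qed.

(** Expand [x] in the standard basis, then use the triangle inequality and homogeneity. *)
Lemma is_norm_le_sum x :
  N x <= \sum_k normc (x k) * N [ffun j => (j == k)%:R].
Proof.
have {1}-> : x = \sum_k x k *: [ffun j => (j == k)%:R].
  apply/ffunP => j; rewrite sum_ffunE (bigD1 j) //= big1 ?addr0.
    by rewrite !ffunE eqxx /GRing.scale /= mulr1.
  by move=> k kj; rewrite !ffunE eq_sym (negbTE kj) scaler0.
elim/big_ind2 : _ => [|a x' b y' xa yb|k _]; rewrite ?is_norm0 ?NZ//.
exact: le_trans (ND _ _) (lerD xa yb).
Qed.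

Lemma continuous_is_norm (T : topologicalType) (F : T -> {ffun K -> R[i]}) :
  (forall k, continuous (fun t => F t k : R[i]^o)) ->
  continuous (fun t => N (F t)).
Proof.
move=> cF t; apply/cvgrPdist_lt => e e0.
(* [g s] dominates [N (F t - F s)], hence also [|N (F t) - N (F s)|]; it is continuous and vanishes
   at [t]. *)
pose g s := \sum_k normc (F t k - F s k) * N [ffun j => (j == k)%:R].
have cg : continuous g.
  apply: continuous_sumR => k s; apply: cvgM; last exact: cvg_cst.
  apply: (@continuous_normc R T (fun s => F t k - F s k)) => s'.
  by apply: (@cvgB R[i] R[i]^o); [exact: cvg_cst|exact: cF].
have gt0 : g t = 0.
  by apply: big1 => k _; rewrite subrr normc0 mul0r.
have /cvgrPdist_lt /(_ _ e0) := cg t.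
apply: filterS => s; rewrite gt0 sub0r normrN => ge.
apply: le_lt_trans (is_norm_dist _ _) _.
apply: le_lt_trans (is_norm_le_sum _) _.
under eq_bigr do rewrite !ffunE.
exact: le_lt_trans (ler_norm _) ge.
Qed.

(** The constant is the minimum of [N] on the unit sphere of the sum of moduli, a closed bounded
    set; homogeneity extends the bound to every [x]. *)
Lemma is_norm_ge_sum :
  exists2 c : R, 0 < c &
    forall x : {ffun K -> R[i]}, c * \sum_k normc (x k) <= N x.
Proof.
pose E := prod_topology (fun _ : K => R[i]^o).
pose s (x : K -> R[i]) := \sum_k normc (x k).
have s_ge0 x : 0 <= s x by apply: sumr_ge0 => k _; exact: normc_ge0.
have cs : continuous (fun x : E => s x).
  apply: continuous_sumR => k; apply: continuous_normc.
  exact: continuous_coord.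
pose S : set E := [set x | s x = 1].
have normalize (x : {ffun K -> R[i]}) :
    s x != 0 -> S (fun k => (s x)^-1%:C * x k).
  move=> sx; rewrite /S /= /s.
  transitivity ((s x)^-1 * \sum_k normc (x k)); last exact: mulVf.
  rewrite mulr_sumr; apply: eq_bigr => k _.
  by rewrite normcM normc_real ger0_norm // invr_ge0 s_ge0.
(* The sphere is empty when [K] is; then [s] vanishes identically and any constant works. *)
have [S0|/set0P/negP] := pselect (S !=set0); last first.
  rewrite negbK => /eqP S0; exists 1 => // x; rewrite mul1r -/(s x).
  have [->//|/normalize] := eqVneq (s x) 0.
  by rewrite S0.
have cS : closed S.
  apply: (@preimage_closed _ _ (fun x : E => s x) [set 1])
    (closed_eq (y := 1)).
  by move=> x _; exact: cs.
have SB (x : E) : S x -> forall j, normc (x j) <= 1.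
  move=> /= <- j; rewrite /s (bigD1 j) //= lerDl.
  by apply: sumr_ge0 => k _; exact: normc_ge0.
have cN : continuous (fun x : E => N [ffun k => x k]).
  apply: continuous_is_norm => k.
  have -> : (fun x : E => [ffun k => x k] k) = (fun x : E => x k).
    by apply/funext => x; rewrite ffunE.
  exact: continuous_coord.
have [x Sx xmin] := bounded_closed_min S0 cS SB cN.
(* Were this minimum 0, [x] would be 0, against [s x = 1]. *)
exists (N [ffun k => x k]).
  rewrite lt_neqAle N_ge0 andbT eq_sym; apply/eqP => /N_eq0 x0.
  have : s x = 0.
    apply: big1 => k _; have /ffunP/(_ k) := x0.
    by rewrite !ffunE => ->; rewrite normc0.
  by rewrite Sx => /eqP; rewrite oner_eq0.
move=> y; rewrite -/(s y).
have [->|sy] := eqVneq (s y) 0; first by rewrite mulr0.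
have := xmin _ (normalize y sy).
have -> : [ffun k => (s y)^-1%:C * y k] = (s y)^-1%:C *: y.
  by apply/ffunP => k; rewrite !ffunE.
rewrite NZ normc_real ger0_norm ?invr_ge0// => h.
have sy_gt0 : 0 < s y by rewrite lt_neqAle eq_sym sy s_ge0.
by rewrite -ler_pdivlMr // [leRHS]mulrC.
Qed.

End FiniteDimensionalNorm.

(** * Lower bound for combinations of nearly orthogonal unit vectors *)

Lemma sqr_sum_le (R : realType) (r : nat) (a : 'I_r -> R) :
  (\sum_p a p) ^+ 2 <= r%:R * \sum_p a p ^+ 2.
Proof.
have -> : (\sum_p a p) ^+ 2 = \sum_p \sum_q a p * a q.
  by rewrite expr2 big_distrl; apply: eq_bigr => p _; rewrite big_distrr.
(* Both sides become double sums over [p] and [q], compared termwise by the arithmetic-geometric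
   mean inequality. *)
have -> : r%:R * \sum_p a p ^+ 2 = \sum_p \sum_q (a p ^+ 2 + a q ^+ 2) / 2.
  under [RHS]eq_bigr => p _ do
    rewrite -mulr_suml big_split /= sumr_const card_ord.
  rewrite -mulr_suml big_split /= sumr_const card_ord sumrMnl.
  rewrite -!(mulr_natl (\sum_p a p ^+ 2) r).
  by field.
apply: ler_sum => p _; apply: ler_sum => q _.
have := sqr_ge0 (a p - a q); rewrite sqrrB; lra.
Qed.

Section Gram.
Context {R : realType} {K : finType} {r : nat}.
Variables (T : 'I_r -> K -> R[i]) (a : 'I_r -> R[i]) (mu : R).
Hypothesis mu_ge0 : 0 <= mu.
Hypothesis T_unit : forall p, \sum_k T p k * ((T p k)^*)%R = 1.
Hypothesis T_incoherent : forall p q, p != q ->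
  normc (\sum_k T p k * ((T q k)^*)%R) <= mu.

(* Expanding the square, the diagonal terms give [\sum_p |a p|^2] and the
   off-diagonal ones are at most [mu * (\sum_p |a p|)^2]. *)
Lemma gram_lower_bound :
  (1 - r%:R * mu) * \sum_p normc (a p) ^+ 2 <=
  \sum_k normc (\sum_p a p * T p k) ^+ 2.
Proof.
set G := fun p q => \sum_k T p k * ((T q k)^*)%R.
set off := \sum_p \sum_(q | q != p) a p * ((a q)^*)%R * G p q.
set s2 := \sum_p _; set S2 := \sum_k _.
have expand : S2%:C = s2%:C + off.
  transitivity (\sum_p \sum_q a p * ((a q)^*)%R * G p q).
    rewrite rmorph_sum /=.
    under eq_bigr => k _.
      rewrite normc_sqr rmorph_sum big_distrl /=.
      under eq_bigr => p _ do rewrite big_distrr /=.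
      over.
    rewrite exchange_big /=; apply: eq_bigr => p _.
    rewrite exchange_big /=; apply: eq_bigr => q _.
    rewrite /G big_distrr /=; apply: eq_bigr => k _.
    by rewrite rmorphM /= mulrACA.
  rewrite /s2 rmorph_sum -big_split /=; apply: eq_bigr => p _.
  by rewrite (bigD1 p) //= /G T_unit mulr1 normc_sqr.
have off_le : normc off <= mu * (r%:R * s2).
  apply: (@le_trans _ _ (mu * (\sum_p normc (a p)) ^+ 2)); last first.
    by apply: ler_wpM2l => //; exact: sqr_sum_le.
  rewrite expr2 big_distrl big_distrr /=.
  apply: le_trans (normc_sum _ _) _; apply: ler_sum => p _.
  apply: le_trans (normc_sum _ _) _; rewrite big_distrr big_distrr /=.
  rewrite [leRHS](bigID (fun q => q != p)) /= -[leLHS]addr0; apply: lerD.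
    apply: ler_sum => q qp; rewrite !normcM normc_conj mulrC.
    apply: ler_wpM2r; first by rewrite mulr_ge0 ?normc_ge0.
    by apply: T_incoherent; rewrite eq_sym.
  by apply: sumr_ge0 => q _; rewrite !mulr_ge0 ?normc_ge0.
(* [off] is only known as a complex number, so the identity [expand] is turned into an inequality
   through moduli. *)
have : s2 <= S2 + normc off.
  have s2E : s2%:C = S2%:C - off by rewrite expand addrK.
  have s2_ge0 : 0 <= s2 by apply: sumr_ge0 => p _; exact: sqr_ge0.
  have S2_ge0 : 0 <= S2 by apply: sumr_ge0 => p _; exact: sqr_ge0.
  rewrite -[leLHS]ger0_norm// -normc_real s2E.
  apply: le_trans (normcD _ _) _.
  by rewrite normc_real ger0_norm// (@normcN R off).
lra.
Qed.

End Gram.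

(** * Rank-one tensors and dictionaries *)

Lemma hdotE (R : realType) (d : nat) (u v : 'cV[R[i]]_d) :
  hdot u v = \sum_k u k 0 * ((v k 0)^*)%R.
Proof.
by rewrite /hdot dotmxE mxE; apply: eq_bigr => k _; rewrite !mxE.
Qed.

Lemma norm2_eq1 (R : realType) (d : nat) (u : 'cV[R[i]]_d) :
  (norm2 u = 1) <-> (hdot u u = 1).
Proof.
rewrite /norm2; split => [h|->]; last exact: sqrtC1.
by rewrite -[LHS]sqrtCK h expr1n.
Qed.

(** The triple sum factors. Hence rank-one tensors of unit vectors are unit, and their inner
    products are bounded by the product of the three coherences. *)
Lemma hdot_outer (R : realType) (l m n : nat) (u u' : 'cV[R[i]]_l)
    (v v' : 'cV[R[i]]_m) (w w' : 'cV[R[i]]_n) :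
  \sum_k outer u v w k * ((outer u' v' w' k)^*)%R =
  hdot u u' * hdot v v' * hdot w w'.
Proof.
rewrite !hdotE.
rewrite big_distrlr /= pair_bigA /= big_distrlr /= pair_bigA /=.
apply: eq_bigr => -[[i j] k] _ /=; rewrite !ffunE /= !rmorphM /=.
ring.
Qed.

Section Dictionaries.
Context {R : realType} {d r : nat} {mu : R}.
Implicit Type U : 'M[R[i]]_(d, r).

(** The maximum in [coherence] starts from 0, so membership forces [0 <= mu] even without pairs of
    distinct columns; the first clause records this. *)
Lemma dictionariesP U : dictionaries mu U <->
  [/\ 0 <= mu, forall p, hdot (col p U) (col p U) = 1
    & forall p q, p != q -> normc (hdot (col p U) (col q U)) <= mu].
Proof.
split=> [[U1 Umu]|[mu0 U1 Umu]].
  split => [|p|p q pq].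
  - apply: le_trans Umu; rewrite /coherence.
    exact: bigmax_ge_id.
  - exact/norm2_eq1.
  - apply: le_trans Umu.
    exact: (@le_bigmax_cond _ _ _ _ (p, q)
      (fun pq => pq.1 != pq.2)
      (fun pq => normc (hdot (col pq.1 U) (col pq.2 U)))).
split => [p|]; first exact/norm2_eq1.
by apply/bigmax_leP; split => // -[p q] /= pq; exact: Umu.
Qed.

(** The squared moduli in a unit column sum to 1. This bounds the dictionary coordinates in the
    minimisation. *)
Lemma dictionaries_entry {U} i p : dictionaries mu U -> normc (U i p) <= 1.
Proof.
move=> /dictionariesP [_ /(_ p) + _]; rewrite hdotE => U1.
have {}U1 : \sum_k normc (U k p) ^+ 2 = 1.
  apply: complexI; rewrite rmorph_sum /= -[RHS]U1.
  by apply: eq_bigr => k _; rewrite normc_sqr !mxE.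
rewrite -(@ler_pXn2r _ 2) ?nnegrE ?normc_ge0// expr1n -U1 (bigD1 i) //= lerDl.
by apply: sumr_ge0 => k _; exact: sqr_ge0.
Qed.

End Dictionaries.

(** The Gram bound for the rank-one tensors, with [mu1 * mu2 * mu3] as their coherence bound. *)
Lemma outer_lower_bound {R : realType} {l m n r : nat} {mu1 mu2 mu3 : R}
    (a : 'rV[R[i]]_r) (U : 'M[R[i]]_(l, r)) (V : 'M[R[i]]_(m, r))
    (W : 'M[R[i]]_(n, r)) :
  dictionaries mu1 U -> dictionaries mu2 V -> dictionaries mu3 W ->
  (1 - r%:R * (mu1 * mu2 * mu3)) * \sum_p normc (a 0 p) ^+ 2 <=
  \sum_k normc
    ((\sum_(p < r) a 0 p *: outer (col p U) (col p V) (col p W)) k) ^+ 2.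
Proof.
move=> /dictionariesP [mu1_ge0 U1 Umu] /dictionariesP [mu2_ge0 V1 Vmu].
move=> /dictionariesP [mu3_ge0 W1 Wmu].
have -> : \sum_k normc
    ((\sum_(p < r) a 0 p *: outer (col p U) (col p V) (col p W)) k) ^+ 2 =
    \sum_k normc (\sum_p a 0 p * outer (col p U) (col p V) (col p W) k) ^+ 2.
  apply: eq_bigr => k _; rewrite sum_ffunE; congr (normc _ ^+ 2).
  by apply: eq_bigr => p _; rewrite ffunE.
apply: gram_lower_bound => [|p|p q pq]; first by rewrite !mulr_ge0.
  by rewrite hdot_outer U1 V1 W1 !mulr1.
by rewrite hdot_outer !normcM !ler_pM ?mulr_ge0 ?normc_ge0 ?Umu ?Vmu ?Wmu.
Qed.

(** * Closedness, continuity and boundedness for the minimisation *)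

Lemma closed_dictionaries (R : realType) (T : topologicalType) (d r : nat)
    (mu : R) (F : T -> 'M[R[i]]_(d, r)) :
  (forall i p, continuous (fun t => F t i p : R[i]^o)) ->
  closed [set t | dictionaries mu (F t)].
Proof.
move=> cF.
(* For negative [mu] there is no dictionary and the set is empty. *)
have [mu0|/negP mu0] := boolP (0 <= mu); last first.
  rewrite (_ : [set t | _] = set0); first exact: closed0.
  by apply/seteqP; split => // t /dictionariesP [].
have chdot p q :
    continuous (fun t => hdot (col p (F t)) (col q (F t)) : R[i]^o).
  rewrite (_ : (fun _ => _) = (fun t => \sum_k F t k p * ((F t k q)^*)%R)).
    apply: continuous_sumC => k; apply: continuous_mulC; first exact: cF.
    by apply: continuous_conjC; exact: cF.
  by apply/funext => t; rewrite hdotE; apply: eq_bigr => k _; rewrite !mxE.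
(* One shape for both constraints: [z = 1], [e = 0] gives unit norm, and [z = 0], [e = mu] gives
   incoherence. *)
have closed_hdot p q (z : R[i]) (e : R) :
    closed [set t | normc (hdot (col p (F t)) (col q (F t)) - z) <= e].
  apply: (@preimage_closed _ _
    (fun t => normc (hdot (col p (F t)) (col q (F t)) - z)) [set x | x <= e])
    (closed_le (y := e)).
  move=> t _; apply: (@continuous_normc _ _
    (fun t => hdot (col p (F t)) (col q (F t)) - z)).
  by apply: continuous_addC => // s; exact: cvg_cst.
rewrite (_ : [set t | _] =
  (\bigcap_p [set t | normc (hdot (col p (F t)) (col p (F t)) - 1) <= 0]) `&`
  (\bigcap_(pq in [set pq : 'I_r * 'I_r | pq.1 != pq.2])
     [set t | normc (hdot (col pq.1 (F t)) (col pq.2 (F t)) - 0) <= mu])).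
  by apply: closedI; apply: closed_bigI => *; exact: closed_hdot.
apply/seteqP; split => t /=.
  move=> /dictionariesP [_ F1 Fmu]; split => [p _ /=|[p q] /= pq].
    by rewrite F1 subrr normc0.
  by rewrite subr0; exact: Fmu.
move=> [F1 Fmu]; apply/dictionariesP; split => // [p|p q pq].
  apply/eqP; rewrite -subr_eq0; apply/eqP/eq0_normc/eqP.
  by rewrite eq_le normc_ge0 andbT; exact: (F1 p).
by have := Fmu (p, q) pq; rewrite /= subr0.
Qed.

Lemma continuous_approx_error (R : realType) (T : topologicalType)
    (l m n r : nat) (N : tensor R l m n -> R) (A : tensor R l m n)
    (a : T -> 'rV[R[i]]_r) (U : T -> 'M[R[i]]_(l, r)) (V : T -> 'M[R[i]]_(m, r))
    (W : T -> 'M[R[i]]_(n, r)) :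
  is_norm N ->
  (forall p, continuous (fun t => a t 0 p : R[i]^o)) ->
  (forall i p, continuous (fun t => U t i p : R[i]^o)) ->
  (forall i p, continuous (fun t => V t i p : R[i]^o)) ->
  (forall i p, continuous (fun t => W t i p : R[i]^o)) ->
  continuous (fun t => approx_error N A (a t) (U t) (V t) (W t)).
Proof.
move=> normN ca cU cV cW; apply: (continuous_is_norm normN) => -[[i j] k].
(* Each entry of the approximation is a polynomial in the parameters. *)
pose S t : R[i]^o := \sum_p a t 0 p * ((U t i p * V t j p) * W t k p).
have cS : continuous S.
  apply: continuous_sumC => p; apply: continuous_mulC; first exact: ca.
  apply: continuous_mulC; last exact: cW.
  by apply: continuous_mulC; [exact: cU|exact: cV].
rewrite (_ : (fun _ => _) = (fun t => A (i, j, k) - S t : R[i]^o)).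
  by move=> t; apply: (@cvgB R[i] R[i]^o); [exact: cvg_cst|exact: cS].
apply/funext => t; rewrite !ffunE sum_ffunE; congr (_ - _).
by apply: eq_bigr => p _; rewrite !ffunE !mxE.
Qed.

(** An approximation [S] no worse than 0 has [N S <= 2 * N A]. Norm comparison bounds its entries,
    and the Gram bound then controls the coefficients. *)
Lemma coefficient_bound {R : realType} {l m n r : nat}
    {N : tensor R l m n -> R} (A : tensor R l m n) {mu1 mu2 mu3 : R} :
  is_norm N -> mu1 * mu2 * mu3 < 1 / r%:R -> (0 < r)%N ->
  exists2 B : R, 0 <= B & forall (lambda : 'rV[R[i]]_r) U V W,
    dictionaries mu1 U -> dictionaries mu2 V -> dictionaries mu3 W ->
    approx_error N A lambda U V W <= N A -> forall p, normc (lambda 0 p) <= B.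
Proof.
move=> normN mu_lt r_gt0.
have [c c_gt0 cN] := is_norm_ge_sum normN.
set kappa := 1 - r%:R * (mu1 * mu2 * mu3).
(* This is where the coherence hypothesis enters. *)
have kappa_gt0 : 0 < kappa.
  by rewrite subr_gt0 -ltr_pdivlMl ?ltr0n// mulr1 -div1r.
set M := 2 * N A / c.
have NA_ge0 : 0 <= N A by case: normN.
(* As [t <= 1 + t ^+ 2], a bound on the squared modulus bounds the modulus without a square root. *)
exists (1 + M ^+ 2 / kappa).
  by rewrite addr_ge0 // mulr_ge0 ?sqr_ge0 ?invr_ge0 // ltW.
move=> lambda U V W dU dV dW; rewrite /approx_error.
have := outer_lower_bound lambda U V W dU dV dW.
set S := \sum_(p < r) _ *: _; rewrite -/kappa => low err p.
have NS : N S <= 2 * N A.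
  have [_ _ _ ND] := normN; have := ND A (S - A).
  by rewrite addrC subrK -(opprB A S) is_normN //; lra.
have sumS : \sum_k normc (S k) <= M.
  by rewrite ler_pdivlMr // mulrC; exact: le_trans (cN S) NS.
have sqrS : \sum_k normc (S k) ^+ 2 <= M ^+ 2.
  have sumS_ge0 : 0 <= \sum_k normc (S k).
    by apply: sumr_ge0 => k _; exact: normc_ge0.
  (* A sum of squares of nonnegative reals is at most the square of their sum. *)
  apply: (@le_trans _ _ ((\sum_k normc (S k)) ^+ 2));
    last by rewrite ler_sqr ?nnegrE// (le_trans sumS_ge0).
  rewrite expr2 big_distrl /=; apply: ler_sum => k _.
  rewrite expr2; apply: ler_wpM2l; first exact: normc_ge0.
  rewrite (bigD1 k) //= lerDl.
  by apply: sumr_ge0 => j _; exact: normc_ge0.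
have lambdaS : normc (lambda 0 p) ^+ 2 <= M ^+ 2 / kappa.
  rewrite ler_pdivlMr // mulrC; apply: le_trans sqrS; apply: le_trans low.
  apply: ler_wpM2l; first exact: ltW.
  by rewrite (bigD1 p) //= lerDl; apply: sumr_ge0 => q _; exact: sqr_ge0.
apply: le_trans (lerD (lexx 1) lambdaS).
have := sqr_ge0 (normc (lambda 0 p) - 1); have := sqr_ge0 (normc (lambda 0 p)).
rewrite sqrrB expr1n; lra.
Qed.

(** * Attainment of the infimum *)

Theorem theorem4p3 (R : realType) (l m n : nat)
    (N : tensor R l m n -> R) (normN : is_norm N)
    (A : tensor R l m n) (r : nat) (r_gt0 : (0 < r)%N) (mu1 mu2 mu3 : R)
    (neU : @dictionaries R l r mu1 !=set0)
    (neV : @dictionaries R m r mu2 !=set0)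
    (neW : @dictionaries R n r mu3 !=set0)
    (mu_lt : mu1 * mu2 * mu3 < 1 / r%:R) :
  exists (lambda : 'rV[R[i]]_r) (U : 'M[R[i]]_(l, r))
         (V : 'M[R[i]]_(m, r)) (W : 'M[R[i]]_(n, r)),
    [/\ dictionaries mu1 U, dictionaries mu2 V, dictionaries mu3 W
      & approx_error N A lambda U V W = inf (approx_errors r N A mu1 mu2 mu3)].
Proof.
have [B B_ge0 bound] := coefficient_bound A normN mu_lt r_gt0.
(* [J] indexes all scalar unknowns: the coefficients, then the entries of the three matrices. [pack]
   assembles a point from them. *)
pose J := ('I_r + ('I_l * 'I_r + ('I_m * 'I_r + 'I_n * 'I_r)))%type.
pose E := prod_topology (fun _ : J => R[i]^o).
pose lam (x : E) : 'rV[R[i]]_r := \row_p x (inl p).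
pose fU (x : E) : 'M[R[i]]_(l, r) := \matrix_(i, p) x (inr (inl (i, p))).
pose fV (x : E) : 'M[R[i]]_(m, r) := \matrix_(i, p) x (inr (inr (inl (i, p)))).
pose fW (x : E) : 'M[R[i]]_(n, r) := \matrix_(i, p) x (inr (inr (inr (i, p)))).
pose pack (a : 'rV[R[i]]_r) (U : 'M[R[i]]_(l, r)) (V : 'M[R[i]]_(m, r))
    (W : 'M[R[i]]_(n, r)) : E := fun j => match j with
  | inl p => a 0 p
  | inr (inl (i, p)) => U i p
  | inr (inr (inl (i, p))) => V i p
  | inr (inr (inr (i, p))) => W i p
  end.
have packE a U V W : (lam (pack a U V W) = a) * (fU (pack a U V W) = U) *
    (fV (pack a U V W) = V) * (fW (pack a U V W) = W).
  by do !split; apply/matrixP => i j; rewrite !mxE ?ord1.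
have clam p : continuous (fun x => lam x 0 p : R[i]^o).
  rewrite (_ : (fun _ => _) = (fun x : E => x (inl p))).
    exact: continuous_coord.
  by apply/funext => x; rewrite mxE.
have cU i p : continuous (fun x => fU x i p : R[i]^o).
  rewrite (_ : (fun _ => _) = (fun x : E => x (inr (inl (i, p))))).
    exact: continuous_coord.
  by apply/funext => x; rewrite mxE.
have cV i p : continuous (fun x => fV x i p : R[i]^o).
  rewrite (_ : (fun _ => _) = (fun x : E => x (inr (inr (inl (i, p)))))).
    exact: continuous_coord.
  by apply/funext => x; rewrite mxE.
have cW i p : continuous (fun x => fW x i p : R[i]^o).
  rewrite (_ : (fun _ => _) = (fun x : E => x (inr (inr (inr (i, p)))))).
    exact: continuous_coord.
  by apply/funext => x; rewrite mxE.
pose err x := approx_error N A (lam x) (fU x) (fV x) (fW x).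
have cerr : continuous err by exact: continuous_approx_error.
(* Feasible points whose coefficients obey the a priori bound. *)
pose D : set E := [set x | dictionaries mu1 (fU x)] `&`
  ([set x | dictionaries mu2 (fV x)] `&` ([set x | dictionaries mu3 (fW x)] `&`
   \bigcap_p [set x | normc (lam x 0 p) <= B])).
have cD : closed D.
  apply: closedI; first exact: closed_dictionaries.
  apply: closedI; first exact: closed_dictionaries.
  apply: closedI; first exact: closed_dictionaries.
  apply: closed_bigI => p _.
  apply: (@preimage_closed _ _ (fun x => normc (lam x 0 p)) [set x | x <= B])
    (closed_le (y := B)).
  by move=> x _; apply: continuous_normc.
have DB (x : E) : D x -> forall j, normc (x j) <= B + 1.
  move=> [dU [dV [dW xB]]] [p|[[i p]|[[i p]|[i p]]]].
  - by have := xB p I; rewrite /= mxE; lra.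
  - by have := dictionaries_entry (U := fU x) i p dU; rewrite mxE; lra.
  - by have := dictionaries_entry (U := fV x) i p dV; rewrite mxE; lra.
  - by have := dictionaries_entry (U := fW x) i p dW; rewrite mxE; lra.
have [[U0 dU0] [V0 dV0] [W0 dW0]] := And3 neU neV neW.
have Dpack (a : 'rV[R[i]]_r) U V W : dictionaries mu1 U -> dictionaries mu2 V ->
    dictionaries mu3 W -> (forall p, normc (a 0 p) <= B) -> D (pack a U V W).
  move=> dU dV dW aB; have [[[ea eU] eV] eW] := packE a U V W.
  split; first by rewrite /= eU.
  split; first by rewrite /= eV.
  split; first by rewrite /= eW.
  by move=> p _; rewrite /= ea.
(* Zero coefficients show that [D] is nonempty and give the reference error [N A]. *)
pose x0 := pack 0 U0 V0 W0.
have Dx0 : D x0 by apply: Dpack => // p; rewrite mxE normc0.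
have errx0 : err x0 = N A.
  rewrite /err /approx_error !packE big1 ?subr0 // => p _.
  by rewrite mxE scale0r.
have [x Dx xmin] := bounded_closed_min (ex_intro _ x0 Dx0) cD DB cerr.
have [dU [dV [dW _]]] := Dx.
exists (lam x), (fU x), (fV x), (fW x); split => //.
have xerr : approx_errors r N A mu1 mu2 mu3 (err x).
  by exists (lam x), (fU x), (fV x), (fW x).
(* A competitor with error at most [N A] lies in [D] by the coefficient bound; any other is beaten
   by [x0]. *)
have lb e : approx_errors r N A mu1 mu2 mu3 e -> err x <= e.
  move=> [a [U [V [W [dU' dV' dW' ->]]]]].
  have [small|large] := leP (approx_error N A a U V W) (N A); last first.
    by apply: le_trans (ltW large); rewrite -errx0; exact: xmin.
  have -> : approx_error N A a U V W = err (pack a U V W).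
    by rewrite /err !packE.
  apply/xmin/Dpack => // p; exact: bound small p.
(* [err x] is both a member and a lower bound, so the set is nonempty and bounded below, as the two
   facts on [inf] require. *)
apply/eqP; rewrite -/(err x) eq_le; apply/andP; split.
  by apply: lb_le_inf => //; exists (err x).
by apply: ge_inf => //; exists (err x).
Qed.
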